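(* The function $\eta(\tau',z)$ vanishes at the point $(\tau_0,x_0)$ if and only if $x_0$ is a ramification point for the Gauss map $G_{\tau_0}$ of the theta divisor of the abelian variety with period matrix $\tau_0$.
   Context: $\mathcal{H}_{g-1}$ is the Siegel upper half-space of symmetric complex $(g-1)\times(g-1)$ matrices with positive definite imaginary part. For $\tau'\in\mathcal{H}_{g-1}$ and $z\in\mathbb{C}^{g-1}$, the theta function is $\theta(\tau',z)=\sum_{m\in\mathbb{Z}^{g-1}}\exp\pi i\left({}^tm\tau' m+2\,{}^tm z\right)$. The theta divisor of the principally polarized abelian variety $\mathbb{C}^{g-1}/(\tau'\mathbb{Z}^{g-1}+\mathbb{Z}^{g-1})$ with period matrix $\tau'$ is the image of $\{z:\theta(\tau',z)=0\}$. The function $\eta$ is considered on the universal theta divisor, i.e. at points $(\tau',z)$ with $\theta(\tau',z)=0$; in particular $(\tau_0,x_0)$ is such a point. Let $dF$ be the column vector with entries $\frac{\partial\theta}{\partial z_i}(\tau',z)$, let $H=\left(\frac{\partial^2\theta}{\partial z_i\partial z_j}(\tau',z)\right)_{i,j}$ be the Hessian matrix, and let $H^c$ be the matrix of cofactors of $H$. Then $$\eta(\tau',z):={}^t dF\,H^c\,dF\,(\tau',z).$$ The Gauss map $G_{\tau'}$ of the theta divisor is the map to $\mathbb{P}^{g-2}$ induced by the gradient, $x\mapsto\left[\frac{\partial\theta}{\partial z_1}(\tau',x):\dots:\frac{\partial\theta}{\partial z_{g-1}}(\tau',x)\right]$. It ramifies at $x$ if there is a nonzero vector $v$ tangent to the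 theta divisor at $x$ (so that $v\cdot dF(x)=0$) with $H(x)v=\lambda\,dF(x)$ for some scalar $\lambda$.
   Formalization: The formal theorem assumes that the gradient dF is nonzero at the point x_0, so that the Gauss map is defined there; at an ordinary double point of the theta divisor η vanishes although the ramification condition fails. *)

(* Defs.v *)
(* MathComp-Analysis; complex numbers are [R[i]] over an arbitrary
   [R : realType], with the topology given by the modulus. *)
From HB Require Import structures.
From mathcomp Require Export all_boot all_order all_algebra.
From mathcomp Require Export complex.
From mathcomp Require Export boolp classical_sets reals topology normedtype.
From mathcomp Require Export sequences derive exp trigo.
From mathcomp Require summability.
Export numFieldNormedType.Exports.

Set Implicit Arguments.
Unset Strict Implicit.
Unset Printing Implicit Defensive.

Import Order.TTheory GRing.Theory Num.Theory.

Local Open Scope classical_set_scope.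
Local Open Scope ring_scope.
Local Open Scope complex_scope.

Definition cexp (R : realType) (z : R[i]) : R[i] :=
  (expR (complex.Re z))%:C * (cos (complex.Im z) +i* sin (complex.Im z)).

Definition siegel (R : realType) (n : nat) : set 'M[R[i]]_n :=
  [set tau | tau^T = tau /\
    forall v : 'cV[R]_n, v != 0 ->
      0 < (v^T *m map_mx (@complex.Im R) tau *m v) 0 0].

Section Theta.
Variables (R : realType) (n : nat).
Implicit Types (tau : 'M[R[i]]_n) (z : 'cV[R[i]]_n).

Definition theta_term tau z (m : 'cV[int]_n) : R[i] :=
  let mC : 'cV[R[i]]_n := map_mx intr m in
  cexp ((pi : R)%:C * 'i *
    ((mC^T *m tau *m mC) 0 0 + 2 * (mC^T *m z) 0 0)).

(* Unordered sum over Z^n: the limit of the partial sums along the finite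
   subsets of Z^n directed by inclusion. *)
Definition theta tau z : R[i]^o :=
  summability.sum (theta_term tau z : _ -> R[i]^o).

(* [derive] is taken over the field R[i]: these are complex derivatives. *)
Definition pderiv (f : 'cV[R[i]]_n -> R[i]^o) (i : 'I_n) :
    'cV[R[i]]_n -> R[i]^o :=
  fun z => 'D_(delta_mx i 0) f z.

Definition theta_grad tau z : 'cV[R[i]]_n :=
  \col_i pderiv (theta tau) i z.

Definition theta_hess tau z : 'M[R[i]]_n :=
  \matrix_(i, j) pderiv (pderiv (theta tau) j) i z.

Definition cofactor_mx (A : 'M[R[i]]_n) : 'M[R[i]]_n :=
  \matrix_(i, j) cofactor A i j.

Definition eta tau z : R[i] :=
  ((theta_grad tau z)^T *m cofactor_mx (theta_hess tau z)
     *m theta_grad tau z) 0 0.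

(* Lift to C^n of the theta divisor of C^n / (tau Z^n + Z^n). *)
Definition theta_divisor tau : set 'cV[R[i]]_n := [set z | theta tau z = 0].

(* The Gauss map, z |-> [theta_grad tau z], takes values in a projective space
   and so is defined exactly where the gradient does not vanish. *)
Definition gauss_domain tau : set 'cV[R[i]]_n :=
  theta_divisor tau `&` [set z | theta_grad tau z != 0].

Definition gauss_ramified tau z : Prop :=
  exists v : 'cV[R[i]]_n,
    [/\ v != 0,
        (v^T *m theta_grad tau z) 0 0 = 0 &
        exists lambda : R[i],
          theta_hess tau z *m v = lambda *: theta_grad tau z].

End Theta.

(* Main.v *)
(* With f the gradient and H the Hessian of theta, the determinant of the
   bordered matrix [[H, f], [f^T, 0]] equals - f^T adj(H) f = - eta.  It vanishes
   if and only if there is a nonzero pair (v, c) with H v + c f = 0 and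
   f^T v = 0, and then v != 0 because f != 0. *)
Require Import Defs.

Import GRing.Theory.
Local Open Scope ring_scope.
Local Open Scope complex_scope.

(** Column elimination without division: a block triangular factor of determinant [\det H] clears
    the upper right corner, because [H *m \adj H] is the scalar matrix [\det H]. Regularity then
    cancels the extra factor [\det H]. *)
Lemma det_bordered_regular (A : comNzRingType) (n : nat)
    (H : 'M[A]_n) (f : 'cV[A]_n) :
  GRing.rreg (\det H) ->
  \det (block_mx H f f^T 0) = - (f^T *m \adj H *m f) 0 0.
Proof.
move=> regH; apply: regH.
have detT : \det (block_mx 1%:M (- (\adj H *m f)) 0 (\det H)%:M : 'M_(n + 1))
          = \det H by rewrite det_ublock det1 mul1r det_scalar1.
rewrite -{1}detT -det_mulmx mulmx_block !mulmx1 !mulmx0 !mul0mx !addr0.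
rewrite !mulmxN mulmxA mul_mx_adj mul_scalar_mx mul_mx_scalar addNr.
by rewrite det_lblock det_mx11 mxE mulrC mulmxA.
Qed.

(* H is the value at 'X = 0 of the matrix 'X%:M + H over {poly A}, whose
   determinant is monic, hence regular. *)
Lemma det_bordered (A : comNzRingType) (n : nat)
    (H : 'M[A]_n) (f : 'cV[A]_n) :
  \det (block_mx H f f^T 0) = - (f^T *m \adj H *m f) 0 0.
Proof.
pose ev0 : {rmorphism {poly A} -> A} := horner_eval (0 : A).
pose K := char_poly_mx (- H); pose k := map_mx polyC f.
have evK : map_mx ev0 K = H.
  apply/matrixP=> i j; rewrite !mxE /ev0 /= /horner_eval.
  by rewrite hornerD hornerN hornerC hornerMn hornerX mul0rn add0r opprK.
have evk : map_mx ev0 k = f.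
  by apply/matrixP=> i j; rewrite !mxE /ev0 /= /horner_eval hornerC.
have regK : GRing.rreg (\det K).
  exact: monic_rreg (char_poly_monic (- H)).
have := congr1 ev0 (@det_bordered_regular _ _ K k regK).
rewrite -det_map_mx map_block_mx -map_trmx evK evk map_mx0 => ->.
rewrite rmorphN; congr (- _).
(* Evaluation is a ring morphism, so it commutes with products and adjugates. *)
transitivity (map_mx ev0 (k^T *m \adj K *m k) 0 0); first by rewrite [RHS]mxE.
by rewrite !map_mxM -map_trmx map_mx_adj evK evk.
Qed.

Lemma det0_kernelP (F : fieldType) (n : nat) (M : 'M[F]_n) :
  \det M = 0 <-> exists2 w : 'cV[F]_n, w != 0 & M *m w = 0.
Proof.
(* [det0P] concerns row vectors killed from the left, hence the transposes. *)
rewrite -det_tr; split.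
  move/eqP/det0P=> [w w0 wM]; exists w^T; first by rewrite trmx_eq0.
  by rewrite -[M]trmxK -trmx_mul wM trmx0.
move=> [w w0 Mw]; apply/eqP/det0P; exists w^T; first by rewrite trmx_eq0.
by rewrite -trmx_mul Mw trmx0.
Qed.

Lemma quad_adj_eq0P (F : fieldType) (n : nat)
    (H : 'M[F]_n) (f : 'cV[F]_n) : f != 0 ->
  (f^T *m \adj H *m f) 0 0 = 0 <->
  exists v : 'cV[F]_n,
    [/\ v != 0, (v^T *m f) 0 0 = 0 & exists c : F, H *m v = c *: f].
Proof.
move=> f0.
have -> : (f^T *m \adj H *m f) 0 0 = 0 <-> \det (block_mx H f f^T 0) = 0.
  by rewrite det_bordered; split=> [->|/eqP]; rewrite ?oppr0 // oppr_eq0 => /eqP.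
rewrite det0_kernelP; split=> [[w]|[v [v0 vf [c Hv]]]].
  rewrite -[w]vsubmxK; set v := usubmx w; set d := dsubmx w => w0.
  rewrite mul_block_col mul0mx addr0 -[0]vsubmxK => /eq_col_mx.
  rewrite !linear0 [d]mx11_scalar mul_mx_scalar => -[Hv fv].
  exists v; split.
  (* If [v] were zero, the upper block would give [d f = 0], so [d = 0] since [f != 0], and the
     whole kernel vector would vanish. *)
  - apply: contraNneq w0 => v0; move: Hv; rewrite v0 mulmx0 add0r => /eqP.
    rewrite scaler_eq0 (negPf f0) orbF => /eqP d0.
    by rewrite [d]mx11_scalar d0 raddf0 col_mx0.
  - by rewrite -[f]trmxK -trmx_mul fv trmx0 mxE.
  - by exists (- d 0 0); apply/eqP; rewrite scaleNr -addr_eq0 Hv.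
(* The last entry [- c] makes the upper block [H v - c f] vanish; the lower one is [f^T v]. *)
exists (col_mx v (- c)%:M); first by rewrite col_mx_eq0 (negPf v0).
rewrite mul_block_col mul0mx addr0 Hv mul_mx_scalar scaleNr subrr.
rewrite -[f^T *m v]trmxK trmx_mul trmxK [v^T *m f]mx11_scalar vf.
by rewrite raddf0 trmx0 col_mx0.
Qed.

(** The adjugate is the transposed cofactor matrix, and a quadratic form, being a 1 x 1 matrix, is
    unchanged when its matrix is transposed. *)
Lemma eta_adj (R : realType) (n : nat) (tau : 'M[R[i]]_n) (z : 'cV[R[i]]_n) :
  eta tau z =
  ((theta_grad tau z)^T *m \adj (theta_hess tau z) *m theta_grad tau z) 0 0.
Proof.
have <- : (cofactor_mx (theta_hess tau z))^T = \adj (theta_hess tau z).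
  by apply/matrixP=> i j; rewrite !mxE.
by rewrite /eta -[RHS]trace_mx11 -mxtrace_tr !trmx_mul !trmxK trace_mx11 mulmxA.
Qed.

Theorem proposition5 (R : realType) (g : nat)
    (tau0 : 'M[R[i]]_(g.-1)) (htau0 : siegel tau0)
    (x0 : 'cV[R[i]]_(g.-1)) (hx0 : gauss_domain tau0 x0) :
  eta tau0 x0 = 0 <-> gauss_ramified tau0 x0.
Proof. by case: hx0 => _ f0; rewrite eta_adj; exact: quad_adj_eq0P. Qed.
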